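(* Let $R$ be a (not necessarily commutative) principal ideal domain which has the $D$-property. Then $R$ is an elementary divisor ring with the $DK$-property if and only if $R$ is a ring with the $EDK$-property.
   Context: Rings are associative (not necessarily commutative) with $1\neq 0$. A principal ideal domain is a domain in which every left ideal and every right ideal is principal. $\mathrm{diag}(d_1,\ldots,d_s)$ denotes a possibly rectangular $n\times m$ matrix, $s=\min(n,m)$, with $d_1,\ldots,d_s$ on the main diagonal and zeros elsewhere. $R$ is an elementary divisor ring if for every (possibly rectangular) matrix $A$ over $R$ there are invertible matrices $P,Q$ of suitable sizes with $PAQ=\mathrm{diag}(d_1,\ldots,d_k,0,\ldots,0)$ and $Rd_{i+1}R\subseteq d_iR\cap Rd_i$ for $i=1,\ldots,k-1$. A nonzero element $a\in R$ is duo if $aR$ and $Ra$ are two-sided ideals and $aR=Ra$. $R$ has the $D$-property if for each $a\in R$ there is $a_*\in R$ with $RaR=a_*R=Ra_*$. $R$ has the $K$-property if each factor of a duo element is a duo element, where $b$ is a factor of $a$ if $a=xby$ for some $x,y\in R$. $R$ has the $DK$-property if it has both the $D$-property and the $K$-property. $R$ has the $EDK$-property if for each (possibly rectangular) matrix $A$ over $R$ there are invertible matrices $P,Q$ of suitable sizes such that $PAQ=\mathrm{diag}(\varepsilon_1,\ldots,\varepsilon_k,0,\ldots,0)$, where $R\varepsilon_{i+1}R\subseteq R\varepsilon_i\cap\varepsilon_iR$ for all $i=1,\ldots,k-1$ and $\varepsilon_1,\ldots,\varepsilon_{k-1}$ are duo elements of $R$. *)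

(* Defs.v *)
From mathcomp Require Import all_boot all_algebra.
From mathcomp Require Import classical_sets.

Set Implicit Arguments.
Unset Strict Implicit.
Unset Printing Implicit Defensive.

Import GRing.Theory.

Local Open Scope ring_scope.
Local Open Scope classical_set_scope.

Section Ideals.
Variable R : nzRingType.
Implicit Types (I : set R) (a b : R).

(* Closure under opposites follows from closure under multiplication by -1. *)
Definition left_ideal I : Prop :=
  [/\ I 0, (forall x y, I x -> I y -> I (x + y))
    & (forall r x, I x -> I (r * x))].

Definition right_ideal I : Prop :=
  [/\ I 0, (forall x y, I x -> I y -> I (x + y))
    & (forall r x, I x -> I (x * r))].

Definition two_sided_ideal I : Prop := left_ideal I /\ right_ideal I.

(* R a *)
Definition lprincipal a : set R := [set x | exists r, x = r * a].

(* a R *)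
Definition rprincipal a : set R := [set x | exists r, x = a * r].

(* R a R, that is, all finite sums of elements x a y *)
Definition tprincipal a : set R :=
  [set x | exists s : seq (R * R), x = \sum_(p <- s) p.1 * a * p.2].

Definition duo a : Prop :=
  [/\ a <> 0, two_sided_ideal (rprincipal a), two_sided_ideal (lprincipal a)
    & rprincipal a = lprincipal a].

Definition factor b a : Prop := exists x y, a = x * b * y.

End Ideals.

Definition domain (R : nzRingType) : Prop :=
  forall x y : R, x * y = 0 -> x = 0 \/ y = 0.

Definition principal_ideal_domain (R : nzRingType) : Prop :=
  [/\ domain R,
      (forall I : set R, left_ideal I -> exists a, I = lprincipal a)
    & (forall I : set R, right_ideal I -> exists a, I = rprincipal a)].

Definition D_property (R : nzRingType) : Prop :=
  forall a : R, exists b : R,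
    tprincipal a = rprincipal b /\ rprincipal b = lprincipal b.

Definition K_property (R : nzRingType) : Prop :=
  forall a b : R, duo a -> factor b a -> duo b.

Definition DK_property (R : nzRingType) : Prop :=
  D_property R /\ K_property R.

(* unitmx is only available over commutative rings. *)
Definition invertible_mx (R : nzRingType) n (P : 'M[R]_n) : Prop :=
  exists P' : 'M[R]_n, P *m P' = 1%:M /\ P' *m P = 1%:M.

(* The n x m matrix diag(d_1, ..., d_k, 0, ..., 0), where k = size d and
   d_(i+1) = d`_i; the trailing zeros come from d`_i = 0 for i >= size d. *)
Definition rect_diag_mx (R : nzRingType) n m (d : seq R) : 'M[R]_(n, m) :=
  \matrix_(i < n, j < m) (if i == j :> nat then d`_i else 0).

Definition total_divisor_chain (R : nzRingType) (d : seq R) : Prop :=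
  forall i, (i.+1 < size d)%N ->
    tprincipal d`_i.+1 `<=` rprincipal d`_i `&` lprincipal d`_i.

Definition elementary_divisor_ring (R : nzRingType) : Prop :=
  forall n m (A : 'M[R]_(n, m)),
  exists (P : 'M[R]_n) (Q : 'M[R]_m) (d : seq R),
    [/\ invertible_mx P, invertible_mx Q, (size d <= minn n m)%N,
        P *m A *m Q = rect_diag_mx n m d
      & total_divisor_chain d].

(* The last element d_k of the chain need not be duo. *)
Definition EDK_property (R : nzRingType) : Prop :=
  forall n m (A : 'M[R]_(n, m)),
  exists (P : 'M[R]_n) (Q : 'M[R]_m) (d : seq R),
    [/\ invertible_mx P, invertible_mx Q, (size d <= minn n m)%N,
        P *m A *m Q = rect_diag_mx n m d
      & total_divisor_chain d /\
        forall i, (i.+1 < size d)%N -> duo d`_i].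

(* Main.v *)
Require Import Defs.
From mathcomp Require Import all_boot all_algebra.
From mathcomp Require Import classical_sets.

(** An elementary divisor form becomes an [EDK] form once its trailing zeros are
    dropped: if [d_(i+1)] is nonzero, then [R d_(i+1) R = bR = Rb] for some duo
    element [b], and [b] lies in [d_i R], so that [d_i] is a factor of [b] and
    is duo by the K-property.

    Conversely, suppose that [R] has the [EDK] property and let [b] be a factor
    of a duo element [a].  In a domain, [a = b z] for some [z].  The matrix
    [M = diag(b, a)] is equivalent to some [E = diag(e1, e2)]; here [a] is a
    right multiple of [e2] (lemma [duo_in_diag]), so [e2] is nonzero and [e1] is
    duo, and then [b] is a right multiple of [e1].  Hence [M = E D] with [D]
    diagonal.  So the cokernel of [M], which is isomorphic to that of [E], maps
    onto that of [E] with a kernel measured by [D].  A surjective endomorphism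
    of a Noetherian module is injective, so [D] must be invertible.  This is
    made concrete by lemma [colspace_stable]: from [M = P M W] with [P]
    invertible, the column spaces of [M], [P M], [P^2 M], and so on ascend,
    hence stabilise, and [P] can be cancelled.  Thus [b = e1 u] with [u] a unit,
    and [b] is duo along with [e1]. *)

Set Implicit Arguments.
Unset Strict Implicit.
Unset Printing Implicit Defensive.

Import GRing.Theory.

Local Open Scope ring_scope.
Local Open Scope classical_set_scope.

(** * Duo elements and their factors *)

Section Duo.
Variable R : nzRingType.
Implicit Types a b e u v x y : R.

Lemma mem_tprincipal a : tprincipal a a.
Proof. by exists [:: (1, 1)]; rewrite big_seq1 mul1r mulr1. Qed.

Lemma duoP a : a <> 0 -> rprincipal a = lprincipal a -> duo a.
Proof.
move=> a0 eqRL.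
have l : left_ideal (lprincipal a).
  split; first by exists 0; rewrite mul0r.
  - by move=> _ _ [r ->] [s ->]; exists (r + s); rewrite mulrDl.
  - by move=> r _ [s ->]; exists (r * s); rewrite mulrA.
have r : right_ideal (rprincipal a).
  split; first by exists 0; rewrite mulr0.
  - by move=> _ _ [r ->] [s ->]; exists (r + s); rewrite mulrDr.
  - by move=> r _ [s ->]; exists (s * r); rewrite mulrA.
by split=> //; split=> //; [rewrite eqRL | rewrite -eqRL].
Qed.

Lemma duo_mull a x : duo a -> exists y, x * a = a * y.
Proof.
by case=> _ _ _ eqRL; have: rprincipal a (x * a) by rewrite eqRL; exists x.
Qed.

Lemma duo_mulr a x : duo a -> exists y, a * x = y * a.
Proof.
by case=> _ _ _ eqRL; have: lprincipal a (a * x) by rewrite -eqRL; exists x.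
Qed.

Lemma duo_mul_unit e u v : u * v = 1 -> v * u = 1 -> duo e -> duo (e * u).
Proof.
move=> uv vu De; have [e0 _ _ _] := De; apply: duoP.
  by move=> eu0; apply: e0; rewrite -[e]mulr1 -uv mulrA eu0 mul0r.
apply/seteqP; split=> _ [r ->].
- have [s es] := duo_mulr (u * r * v) De.
  by exists s; rewrite mulrA -es -!mulrA vu mulr1.
- have [s es] := duo_mull r De.
  by exists (v * s * u); rewrite mulrA es -!mulrA (mulrA u) uv mul1r.
Qed.

Hypothesis R_dom : domain R.

Lemma domain_mulfI x : x <> 0 -> injective ( *%R x).
Proof.
move=> x0 y z /eqP; rewrite -subr_eq0 -mulrBr => /eqP /R_dom[//|] /eqP.
by rewrite subr_eq0 => /eqP.
Qed.

Lemma domain_inv_sym u v : v * u = 1 -> u * v = 1.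
Proof.
move=> vu; have v0 : v <> 0.
  by move=> v0; move/eqP: vu; rewrite v0 mul0r eq_sym oner_eq0.
by apply: (domain_mulfI v0); rewrite mulrA vu mul1r mulr1.
Qed.

(** If [a = x c], then [x a = a x'] for some [x'], and cancelling [x] gives
    [a = c x']. *)
Lemma factor_duo_left a b : duo a -> factor b a -> exists z, a = b * z.
Proof.
move=> Da [x [y axy]]; have [a0 _ _ _] := Da.
have [x' exa] := duo_mull x Da; exists (y * x').
have x0 : x <> 0 by move=> x0; apply: a0; rewrite axy x0 !mul0r.
by apply: (domain_mulfI x0); rewrite exa {1}axy !mulrA.
Qed.

End Duo.

(** * Ascending chains of column spaces *)

Section Noetherian.
Variable R : nzRingType.
Hypothesis R_pri :
  forall I : set R, right_ideal I -> exists a, I = rprincipal a.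

Lemma right_ideal_acc (I : nat -> set R) :
    (forall k, right_ideal (I k)) -> (forall k, I k `<=` I k.+1) ->
  exists N, forall k, (N <= k)%N -> I k `<=` I N.
Proof.
move=> idI incI.
have leI k l : (k <= l)%N -> I k `<=` I l.
  move/subnKC <-; elim: (l - k)%N => [|d IHd]; first by rewrite addn0.
  by rewrite addnS => x /IHd /incI.
have idU : right_ideal [set x | exists k, I k x].
  split; first by exists 0%N; case: (idI 0%N).
  - move=> x y [k kx] [l ly]; exists (maxn k l).
    case: (idI (maxn k l)) => _ addI _.
    by apply: addI; [apply: leI kx | apply: leI ly]; rewrite ?leq_maxl ?leq_maxr.
  - by move=> r x [k kx]; exists k; case: (idI k) => _ _; apply.
have [a eqU] := R_pri idU.
have [N Na] : [set x | exists k, I k x] a by rewrite eqU; exists 1; rewrite mulr1.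
exists N => k _ x kx.
have [r ->] : rprincipal a x by rewrite -eqU; exists k.
by case: (idI N) => _ _; apply.
Qed.

(** The ascending chain condition for column spaces: the hypothesis says that
    each column space is contained in the next one.  The chain of right ideals
    [I k j] consists of the leading entries, in position [j], of the vectors
    of the [k]-th column space. *)
Lemma colspace_acc n m (A : nat -> 'M[R]_(n, m)) (W : nat -> 'M[R]_m) :
  (forall k, A k = A k.+1 *m W k) -> exists k Z, A k.+1 = A k *m Z.
Proof.
move=> AW.
pose I (j : 'I_n) k : set R := [set c | exists y : 'cV[R]_m,
  (A k *m y) j 0 = c /\ forall i : 'I_n, (i < j)%N -> (A k *m y) i 0 = 0].
have /fin_all_exists[N NP] j : exists N, forall k, (N <= k)%N -> I j k `<=` I j N.
  apply: right_ideal_acc => k.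
    split; first by exists 0; split=> [|i _]; rewrite mulmx0 mxE.
    - move=> _ _ [y [<- y0]] [z [<- z0]]; exists (y + z).
      by split=> [|i ij]; rewrite mulmxDr mxE // y0 // z0 // addr0.
    - move=> r _ [y [<- y0]]; exists (y *m r%:M).
      have yr i : (A k *m (y *m r%:M)) i 0 = (A k *m y) i 0 * r.
        by rewrite mulmxA mxE big_ord1 [r%:M _ _]mxE eqxx mulr1n.
      by split=> [|i ij]; rewrite yr // y0 // mul0r.
  by move=> _ [y [<- y0]]; exists (W k *m y); rewrite mulmxA -AW.
have incI j k d : I j k `<=` I j (k + d)%N.
  elim: d => [|d IHd]; first by rewrite addn0.
  move=> x /IHd [y [<- y0]]; rewrite addnS.
  by exists (W (k + d)%N *m y); rewrite mulmxA -AW.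
pose k := \max_j N j; exists k.
have stepI j : I j k.+1 `<=` I j k.
  have le_k : (N j <= k)%N by apply: (leq_bigmax j).
  by rewrite -[X in _ `<=` I j X](subnKC le_k) => x /NP /incI; apply; apply: leqW.
(* Clear the entries of a vector of the larger space one after the other. *)
have clear y l : (l <= n)%N -> exists y' : 'cV[R]_m,
    forall i : 'I_n, (i < l)%N -> (A k.+1 *m y - A k *m y') i 0 = 0.
  elim: l => [|l IHl] ltln; first by exists 0.
  have [y' y'0] := IHl (ltnW ltln).
  have eqv : A k.+1 *m y - A k *m y' = A k.+1 *m (y - W k *m y').
    by rewrite mulmxBr [A k]AW mulmxA.
  have [v [vl v0]] : I (Ordinal ltln) k ((A k.+1 *m y - A k *m y') (Ordinal ltln) 0).
    apply: stepI; exists (y - W k *m y').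
    by rewrite -eqv; split=> // i /y'0.
  exists (y' + v) => i; rewrite ltnS leq_eqVlt mulmxDr opprD addrA => /orP[/eqP il|il].
    have -> : i = Ordinal ltln by apply: val_inj.
    by rewrite mxE [(- (A k *m v)) _ _]mxE vl subrr.
  by rewrite mxE [(- (A k *m v)) _ _]mxE y'0 // v0 // subrr.
have /fin_all_exists[z zP] (j : 'I_m) : exists y', col j (A k.+1) = A k *m y'.
  have [y' y'0] := clear (delta_mx j 0) n (leqnn n).
  exists y'; apply/eqP; rewrite -subr_eq0 colE; apply/eqP/matrixP=> i o.
  by rewrite ord1 y'0 // mxE.
exists (\matrix_(i, j) z j i 0); apply/matrixP=> i j.
have := congr1 (fun v : 'cV[R]_n => v i 0) (zP j); rewrite mxE => ->.
by rewrite !mxE; apply: eq_bigr => l _; rewrite mxE.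
Qed.

(** Equivalently: a surjective endomorphism of the cokernel of [M], here the one
    induced by the inverse of [P], is injective. *)
Lemma colspace_stable n m (M : 'M[R]_(n, m)) (P : 'M[R]_n) (W : 'M[R]_m) :
  invertible_mx P -> M = P *m M *m W -> exists Z, P *m M = M *m Z.
Proof.
move=> [P' [_ P'P]] MW.
have [k|k [Z]] := @colspace_acc n m (fun k => iter k (mulmx P) M) (fun=> W).
  elim: k => [|k IHk] //=.
  by rewrite {1}IHk !mulmxA.
rewrite iterSr => eqk; exists Z.
elim: k eqk => [|k IHk] //= eqk; apply: IHk.
by rewrite -[LHS]mul1mx -P'P -mulmxA eqk !mulmxA P'P mul1mx.
Qed.

End Noetherian.

(** * Equivalence of diagonal matrices *)

Section Diagonal.
Variable R : nzRingType.
Implicit Types d : seq R.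

Lemma mul_rect_diag_mx n m d (Y : 'M[R]_(n, m)) i j :
  (rect_diag_mx n n d *m Y) i j = d`_i * Y i j.
Proof.
rewrite mxE (bigD1 i) //= mxE eqxx big1 ?addr0 // => k ki.
by rewrite mxE val_eqE eq_sym (negPf ki) mul0r.
Qed.

Lemma mul_mx_rect_diag n m d (Y : 'M[R]_(m, n)) i j :
  (Y *m rect_diag_mx n n d) i j = Y i j * d`_j.
Proof.
rewrite mxE (bigD1 j) //= mxE eqxx big1 ?addr0 // => k kj.
by rewrite mxE val_eqE (negPf kj) mulr0.
Qed.

(** With [P A Q] the diagonal matrix of [d], the hypothesis on [Y] says that
    [A] divides the scalar matrix [a]; each entry [d_i] then divides [a].  Since
    [a] is duo, it can be moved across the entries of the inverse of [P]. *)
Lemma duo_in_diag n (P Y : 'M[R]_n) d a (i : 'I_n) :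
    duo a -> invertible_mx P -> P *m a%:M = rect_diag_mx n n d *m Y ->
  rprincipal d`_i a.
Proof.
move=> Da [P' [PP' _]] eqPa.
have /fin_all_exists[c cP] k := duo_mull (P' k i) Da.
exists (\sum_k Y i k * c k); rewrite mulr_sumr.
have -> : a = (P *m P') i i * a by rewrite PP' mxE eqxx mul1r.
rewrite mxE mulr_suml; apply: eq_bigr => k _.
rewrite -mulrA cP !mulrA -mul_rect_diag_mx -eqPa; congr (_ * _).
rewrite mxE (bigD1 k) //= mxE eqxx mulr1n big1 ?addr0 // => l lk.
by rewrite mxE (negPf lk) mulr0.
Qed.

(** If [diag(e)] is equivalent to [diag(a)], all entries of [a] being nonzero, and
    [diag(a) = diag(e) diag(u)], then the entries of [u] are units. *)
Lemma diag_quotient_unit n (a e u : seq R) (P Q : 'M[R]_n) :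
    domain R ->
    (forall I : set R, right_ideal I -> exists c, I = rprincipal c) ->
    invertible_mx P -> (forall i : 'I_n, a`_i <> 0) ->
    P *m rect_diag_mx n n a *m Q = rect_diag_mx n n e ->
    (forall i : 'I_n, a`_i = e`_i * u`_i) ->
  forall i : 'I_n, exists v, v * u`_i = 1 /\ u`_i * v = 1.
Proof.
move=> R_dom R_pri invP a0 eqPQ aeu i.
pose M := rect_diag_mx n n a; pose D := rect_diag_mx n n u.
have MD : M = P *m M *m (Q *m D).
  rewrite mulmxA eqPQ; apply/matrixP=> k l.
  by rewrite mul_rect_diag_mx !mxE; case: eqP => _; rewrite ?mulr0 // aeu.
have [Z PMZ] := colspace_stable R_pri invP MD.
exists ((Z *m Q) i i).
suff vu : (Z *m Q) i i * u`_i = 1 by split=> //; apply: domain_inv_sym vu.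
rewrite -mul_mx_rect_diag; apply: (domain_mulfI R_dom (a0 i)).
rewrite -mul_rect_diag_mx -/M -/D -mulmxA mulmxA -PMZ -MD.
by rewrite mxE eqxx mulr1.
Qed.

End Diagonal.

(** * Elementary divisors with duo entries *)

Section Equivalence.
Variable R : nzRingType.

(** Cutting at the first zero entry leaves the diagonal matrix unchanged, since
    every later entry of a total divisor chain vanishes. *)
Lemma truncate_chain (d : seq R) :
    total_divisor_chain d ->
  exists2 c, [/\ (size c <= size d)%N, total_divisor_chain c
               & forall i, c`_i = d`_i]
           & forall i, (i < size c)%N -> c`_i <> 0.
Proof.
move=> chd; pose k := find (pred1 0) d; have le_k := find_size (pred1 0) d.
have sz : size (take k d) = k by rewrite size_takel.
have d0 i : (k <= i)%N -> d`_i = 0.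
  move/subnKC <-; elim: (i - k)%N => [|l IHl].
    rewrite addn0; case: (ltnP k (size d)) => [ltk|]; last exact: nth_default.
    by apply/eqP; apply: (@nth_find _ 0 (pred1 0)); rewrite has_find.
  rewrite addnS; case: (ltnP (k + l).+1 (size d)) => [ltl|]; last exact: nth_default.
  have [+ _] := chd _ ltl _ (mem_tprincipal _).
  by rewrite IHl => -[r ->]; rewrite mul0r.
have eqd i : (take k d)`_i = d`_i.
  case: (ltnP i k) => [lt_ik|le_ki]; first by rewrite nth_take.
  by rewrite d0 // nth_default ?sz.
exists (take k d).
  split=> //; first by rewrite sz.
  move=> i; rewrite sz !eqd => lti; apply: chd.
  exact: leq_trans lti le_k.
by move=> i; rewrite sz eqd => /(before_find 0) /= /eqP.
Qed.

Lemma EDR_DK_EDK :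
  elementary_divisor_ring R -> DK_property R -> EDK_property R.
Proof.
move=> edr [R_D R_K] n m A.
have [P [Q [d [invP invQ sz eqA /truncate_chain[c [szc chc eqc] c0]]]]] := edr n m A.
exists P, Q, c; split=> //; first exact: leq_trans sz.
  by rewrite eqA; apply/matrixP=> i j; rewrite !mxE eqc.
split=> // i lti; have [b [eqt eqb]] := R_D c`_i.+1.
have cb : rprincipal b c`_i.+1 by rewrite -eqt; apply: mem_tprincipal.
have Db : duo b.
  apply: duoP eqb => b0; apply: (c0 _ lti).
  by case: cb => r ->; rewrite b0 mul0r.
have [[y by_] _] : (rprincipal c`_i `&` lprincipal c`_i) b.
  by apply: chc => //; rewrite eqt; exists 1; rewrite mulr1.
by apply: (R_K _ _ Db); exists 1, y; rewrite mul1r.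
Qed.

Lemma EDK_EDR : EDK_property R -> elementary_divisor_ring R.
Proof.
by move=> edk n m A; have [P [Q [d [? ? ? ? [? _]]]]] := edk n m A; exists P, Q, d.
Qed.

Lemma EDK_K : principal_ideal_domain R -> EDK_property R -> K_property R.
Proof.
move=> [R_dom _ R_pri] edk a b Da ba.
have [z abz] := factor_duo_left R_dom Da ba; have [a0 _ _ _] := Da.
have b0 : b <> 0 by move=> b0; apply: a0; rewrite abz b0 mul0r.
pose M := rect_diag_mx 2 2 [:: b; a].
have [P [Q [e [invP [Q' [QQ' _]] sz eqE [che duoe]]]]] := edk 2 2 M.
have [P' [_ P'P]] := invP.
have [t at_] : rprincipal e`_1 a.
  apply: (duo_in_diag (Y := Q' *m rect_diag_mx 2 2 [:: z; 1]) 1 Da invP).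
  (* a%:M = M *m diag(z, 1) because a = b z *)
  rewrite -eqE -!mulmxA (mulmxA Q) QQ' mul1mx; congr (_ *m _).
  apply/matrixP=> i j; rewrite mul_rect_diag_mx !mxE.
  case: i j => [[|[|//]] ?] [[|[|//]] ?] //=; rewrite ?mulr0 ?mulr1n ?mulr0n ?mulr1 //.
have sz2 : (1 < size e)%N.
  rewrite ltnNge; apply/negP=> le1; apply: a0.
  by rewrite at_ nth_default // mul0r.
have De0 : duo e`_0 by apply: duoe.
have [[r e1r] _] := che _ sz2 _ (mem_tprincipal _).
have [u bu] : rprincipal e`_0 b.
  have [_ [_ [_ addI mulI]] [[_ _ lmulI] _] eqRL] := De0.
  rewrite -eqRL in lmulI.
  have -> : b = M 0 0 by rewrite mxE.
  have -> : M = P' *m rect_diag_mx 2 2 e *m Q'.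
    by rewrite -eqE -!mulmxA QQ' mulmx1 mulmxA P'P mul1mx.
  rewrite mxE big_ord_recl big_ord1 !mul_mx_rect_diag.
  apply: addI; apply: mulI; apply: lmulI; first by exists 1; rewrite mulr1.
  by exists r.
have [||v [vu uv]] :=
    diag_quotient_unit (u := [:: u; t]) R_dom R_pri invP _ eqE _ (ord0 : 'I_2).
- by case=> [[|[|//]] ?].
- by case=> [[|[|//]] ?].
by rewrite bu; apply: duo_mul_unit De0; [apply: uv | apply: vu].
Qed.

End Equivalence.

Theorem theorem2p3 (R : nzRingType)
    (R_pid : principal_ideal_domain R) (R_D : D_property R) :
  elementary_divisor_ring R /\ DK_property R <-> EDK_property R.
Proof.
split=> [[edr dk]|edk]; first exact: EDR_DK_EDK.
by split; [apply: EDK_EDR | split=> //; apply: EDK_K].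
Qed.
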